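(* Any digraph that has sign symmetric $P_{0,1}^+$-completion also has sign symmetric $P_{0,1}$-completion.
   Context: A real $n\times n$ matrix is a $P_0$-matrix if every principal minor is nonnegative; a $P_{0,1}$-matrix is a $P_0$-matrix with positive diagonal entries. A real $n\times n$ matrix is a $P_0^+$-matrix if for each $k\in\{1,\dots,n\}$ every $k\times k$ principal minor is nonnegative and at least one $k\times k$ principal minor is positive; a $P_{0,1}^+$-matrix is a $P_0^+$-matrix with positive diagonal entries. A matrix is sign symmetric if for all $i\neq j$, either $a_{ij}a_{ji}>0$ or $a_{ij}=a_{ji}=0$. A partial matrix (some entries specified, others unspecified) specifies a digraph $D$ (loops allowed) if entry $(i,j)$ is specified exactly when $(v_i,v_j)$ is an arc of $D$ (diagonal entries correspond to loops). A partial sign symmetric $P_{0,1}^+$-matrix (resp. $P_{0,1}$-matrix) is a partial matrix whose specified diagonal entries are positive, whose fully specified pairs of twin entries satisfy the sign symmetry condition, and whose fully specified principal minors are nonnegative (with the full conditions holding if the matrix is fully specified). A digraph has sign symmetric $P_{0,1}^+$-completion (resp. $P_{0,1}$-completion) if every partial sign symmetric $P_{0,1}^+$-matrix (resp. $P_{0,1}$-matrix) specifying it can be completed, by choosing values of the unspecified entries, to a sign symmetric $P_{0,1}^+$-matrix (resp. $P_{0,1}$-matrix). *)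

(* Defs.v *)
From mathcomp Require Import all_boot all_order all_algebra.
From mathcomp Require Import reals.

Set Implicit Arguments.
Unset Strict Implicit.
Unset Printing Implicit Defensive.

Import Order.TTheory GRing.Theory Num.Theory.
Local Open Scope ring_scope.

Section Matrices.
Variables (R : realType) (n : nat).
Implicit Types (A : 'M[R]_n) (S : {set 'I_n}).

Definition principal_minor A S : R :=
  \det (mxsub (fun i : 'I_#|S| => enum_val i) (fun i : 'I_#|S| => enum_val i) A).

(* S = set0 is included, harmlessly: its minor is 1. *)
Definition P0_matrix A : Prop := forall S, 0 <= principal_minor A S.

Definition P0p_matrix A : Prop :=
  forall k : nat, (1 <= k <= n)%N ->
    (forall S, #|S| = k -> 0 <= principal_minor A S) /\
    (exists2 S : {set 'I_n}, #|S| = k & 0 < principal_minor A S).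

Definition pos_diag A : Prop := forall i, 0 < A i i.

Definition P01_matrix A : Prop := P0_matrix A /\ pos_diag A.

Definition P01p_matrix A : Prop := P0p_matrix A /\ pos_diag A.

Definition sign_sym_pair (a b : R) : Prop := 0 < a * b \/ (a = 0 /\ b = 0).

Definition sign_symmetric A : Prop :=
  forall i j, i != j -> sign_sym_pair (A i j) (A j i).

Definition ss_P01_matrix A : Prop := sign_symmetric A /\ P01_matrix A.

Definition ss_P01p_matrix A : Prop := sign_symmetric A /\ P01p_matrix A.

End Matrices.

Section PartialMatrices.
Variables (R : realType) (n : nat).
(* [None] marks an unspecified entry. *)
Implicit Types (M : 'M[option R]_n) (D : rel 'I_n).

Definition specifies M D : Prop := forall i j, isSome (M i j) = D i j.

Definition fully_specified_on M (S : {set 'I_n}) : Prop :=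
  forall i j, i \in S -> j \in S -> isSome (M i j).

Definition fully_specified M : Prop := forall i j, isSome (M i j).

(* Only used where the entries involved are specified, so the default value 0
   is never read. *)
Definition values M : 'M[R]_n := map_mx (odflt 0) M.

Definition partial_pos_diag M : Prop :=
  forall i a, M i i = Some a -> 0 < a.

Definition partial_sign_symmetric M : Prop :=
  forall i j a b, i != j -> M i j = Some a -> M j i = Some b ->
    sign_sym_pair a b.

Definition partial_nonneg_minors M : Prop :=
  forall S, fully_specified_on M S -> 0 <= principal_minor (values M) S.

Definition partial_ss_P01_matrix M : Prop :=
  [/\ partial_pos_diag M, partial_sign_symmetric M, partial_nonneg_minors M
    & fully_specified M -> ss_P01_matrix (values M)].

Definition partial_ss_P01p_matrix M : Prop :=
  [/\ partial_pos_diag M, partial_sign_symmetric M, partial_nonneg_minors M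
    & fully_specified M -> ss_P01p_matrix (values M)].

Definition completes (A : 'M[R]_n) M : Prop :=
  forall i j a, M i j = Some a -> A i j = a.

End PartialMatrices.

Definition has_ss_P01_completion (R : realType) n (D : rel 'I_n) : Prop :=
  forall M : 'M[option R]_n, specifies M D -> partial_ss_P01_matrix M ->
    exists2 A : 'M[R]_n, completes A M & ss_P01_matrix A.

Definition has_ss_P01p_completion (R : realType) n (D : rel 'I_n) : Prop :=
  forall M : 'M[option R]_n, specifies M D -> partial_ss_P01p_matrix M ->
    exists2 A : 'M[R]_n, completes A M & ss_P01p_matrix A.

(* Main.v *)
(* A partial matrix with an unspecified entry is a partial sign symmetric
   P_{0,1}^+-matrix as soon as it is a partial sign symmetric P_{0,1}-matrix,
   since the two notions differ only on fully specified matrices; and a fully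
   specified matrix is its own completion. *)
Require Import Defs.
From mathcomp Require Import all_boot all_order all_algebra.
From mathcomp Require Import reals.

(** A nonempty [S] is covered by [P0p_matrix] at [k = #|S|]; the empty set lies outside the range
    [1 <= k], but its minor is 1. *)
Lemma P0p_P0 (R : realType) (n : nat) (A : 'M[R]_n) :
  P0p_matrix A -> P0_matrix A.
Proof.
move=> PA S; case: (posnP #|S|) => [S0 | S_gt0].
  (* The type of [enum_val] depends on [#|S|], so it is generalized before [#|S|] is rewritten to
     0. *)
  by rewrite /principal_minor; move: (@enum_val _ (mem S)); rewrite S0 => f;
    rewrite det_mx00 Num.Theory.ler01.
by have [|minors_ge0 _] := PA #|S|; [rewrite S_gt0 -[leqRHS]card_ord max_card
  | exact: minors_ge0].
Qed.

Lemma completes_values (R : realType) (n : nat) (M : 'M[option R]_n) :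
  completes (values M) M.
Proof. by move=> i j a Mij; rewrite mxE Mij. Qed.

Theorem theorem4p4 (R : realType) (n : nat) (D : rel 'I_n) :
  has_ss_P01p_completion R D -> has_ss_P01_completion R D.
Proof.
move=> compD M specM [posM symM minM fullM].
case: (boolP [forall i, forall j, M i j : bool]) => [/forallP full | notfull].
  exists (values M); first exact: completes_values.
  by apply: fullM => i j; apply: (forallP (full i)).
have [|A complA [symA [P0pA posA]]] := compD M specM; last first.
  by exists A => //; do 2!split=> //; apply: P0p_P0.
(* Only the clause on full specification differs, and it is vacuous because [M] has an unspecified
   entry. *)
split=> // full; case/negP: notfull.
by apply/forallP => i; apply/forallP => j; apply: full.
Qed.
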